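(* The two-variable parity polynomial $\mathbf{P}_K(x,y)$ and the affine index polynomial $AI_K(t)$ are equivalent invariants of virtual knotoids; that is, for any two oriented virtual knotoids $K_1$ and $K_2$, $$AI_{K_1}(t)=AI_{K_2}(t)\iff \mathbf P_{K_1}(x,y)=\mathbf P_{K_2}(x,y).$$
   Context: **Virtual knotoids.** A knotoid diagram in $S^2$ is a generic immersion of $[0,1]$ into the oriented sphere $S^2$ with finitely many transverse double points, each endowed with over/under information (classical crossings). The images of $0$ and $1$ are the tail and the head; they are distinct from each other and from all crossings. The diagram is oriented from tail to head. A virtual knotoid diagram may also have virtual crossings (double points marked by a small circle, with no over/under information). A virtual knotoid is an equivalence class of virtual knotoid diagrams under isotopy and the generalized Reidemeister moves: the classical moves $\Omega_1,\Omega_2,\Omega_3$ (performed away from the endpoints); their analogues $\Omega_1^v,\Omega_2^v,\Omega_3^v$ with all crossings virtual; the mixed move $\Omega_3^m$ (a strand having virtual crossings with both strands of a classical crossing is moved across that classical crossing); and the move $\Omega_v$ (an endpoint is moved across a strand, creating or removing a virtual crossing). Moving an endpoint over or under a strand so as to create or remove a classical crossing is forbidden. **Sign.** Draw a classical crossing $c$ with both strands directed upward. Then $\operatorname{sgn}(c)=1$ if the over-strand goes from bottom left to top right, and $\operatorname{sgn}(c)=-1$ if the over-strand goes from bottom right to top left. $C(D)$ is the set of classical crossings of $D$. **Labels and weight.** Arcs are the segments of $D$ between consecutive crossings (or endpoints). Integer labels $\ell$ are assigned to arcs starting from the tail (initial label $0$): at a classical crossing drawn with both strands upward, the label increases by $1$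 along the strand going from bottom right to top left and decreases by $1$ along the strand going from bottom left to top right (regardless of over/under); labels do not change at virtual crossings. If at $c$ the incoming arcs are $\alpha$ (bottom left) and $\beta$ (bottom right), the weight is $W_D(c)=\operatorname{sgn}(c)\big(\ell(\alpha)-(\ell(\beta)+1)\big)$. **Smoothing, parity, intersection index.** The orientation-preserving smoothing at $c$ (joining the bottom-left incoming arc to the top-left outgoing arc and the bottom-right incoming arc to the top-right outgoing arc) gives an ordered two-component diagram $D_1\cup D_2$: if $\operatorname{sgn}(c)=1$, $D_1$ is the component containing the left smoothed strand and $D_2$ the one containing the right smoothed strand; if $\operatorname{sgn}(c)=-1$, $D_1$ contains the right one and $D_2$ the left one. $I(c)$ is the number of classical crossings between $D_1$ and $D_2$; $c$ is even if $I(c)$ is even and odd otherwise. $E(D)$ and $O(D)$ are the sets of even and odd crossings of $D$. For a classical crossing $e$ between $D_1$ and $D_2$ put $\operatorname{ind}(e)=\operatorname{sgn}(e)$ if $D_1$ is the over-strand at $e$, and $\operatorname{ind}(e)=-\operatorname{sgn}(e)$ if $D_2$ is the over-strand at $e$. The intersection index is $i(c)=\sum_{e\in D_1\cap D_2}\operatorname{ind}(e)$, the sum over classical crossings between $D_1$ and $D_2$. **The polynomials.** For a diagram $D$ of a virtual knotoid $K$, $$\mathbf{P}_K(x,y)=\mathbf{P}_D(x,y)=\sum_{c \in E(D)} \operatorname{sgn}(c)\, i(c)\, x^{W_D(c)} + \sum_{c \in O(D)} \operatorname{sgn}(c)\, i(c)\, y^{W_D(c)}\in\mathbb Z[x^{\pm1},y^{\pm1}],$$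 $$AI_K(t)=\sum_{c\in C(D)}\operatorname{sgn}(c)\big(t^{W_D(c)}-1\big)\in\mathbb Z[t^{\pm1}].$$ Both are invariants of $K$ (independent of the choice of $D$). *)

(* Defs.v *)
From Stdlib Require Import Relation_Operators.
From mathcomp Require Import all_boot all_order all_algebra.
From mathcomp Require Import finmap.
From mathcomp Require Import all_classical all_reals all_analysis.

Set Implicit Arguments.
Unset Strict Implicit.
Unset Printing Implicit Defensive.

Import Order.TTheory GRing.Theory Num.Theory.
Import numFieldNormedType.Exports.

Local Open Scope classical_set_scope.
Local Open Scope ring_scope.

Section Diagrams.
Variable R : realType.

Definition sphere : set 'rV[R]_3 := [set p | \sum_i p 0 i ^+ 2 = 1].

(* With the outward normal orientation of the sphere, (u, v) is a positive
   basis of the tangent plane at p exactly when det3 p u v > 0. *)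
Definition det3 (p u v : 'rV[R]_3) : R :=
  \det (col_mx p (col_mx u v) : 'M[R]_3).

(* [Classical b]: the strand passing first through the crossing (from tail to
   head) is the over-strand iff b. *)
Variant crossing_kind := Virtual | Classical of bool.

(* The immersion is the restriction of [curve] to [0, 1]; the values of [curve]
   outside [0, 1] only serve to speak of smoothness up to the endpoints and are
   irrelevant otherwise.  A crossing is the pair (s, t), s < t, of the two
   parameters at which the curve goes through it; [kind] is irrelevant on pairs
   that are not crossings. *)
Record diagram := Diagram {
  curve : R -> 'rV[R]_3;
  crossings : {fset R * R};
  kind : R * R -> crossing_kind;
  curve_sphere : forall t, 0 <= t <= 1 -> sphere (curve t);
  curve_smooth : forall (n : nat) (t : R), derivable (derive1n n curve) t 1;
  curve_immersion : forall t, 0 <= t <= 1 -> derive1 curve t != 0;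
  crossingsP : forall s t, (s, t) \in crossings <->
    [/\ 0 <= s, s < t, t <= 1 & curve s = curve t];
  crossing_transverse : forall s t, (s, t) \in crossings ->
    det3 (curve s) (derive1 curve s) (derive1 curve t) != 0;
  crossing_double : forall s t u, 0 <= s -> s < t -> t < u -> u <= 1 ->
    ~ (curve s = curve t /\ curve t = curve u);
  tail_free : forall t, 0 < t <= 1 -> curve 0 <> curve t;
  head_free : forall t, 0 <= t < 1 -> curve 1 <> curve t
}.

Definition unit_interval : set R := `[0, 1]%classic.

(* Ambient isotopy of the sphere, up to an orientation preserving
   reparametrization [phi] of the curve.  Each [H u] is a continuous bijection
   of a compact Hausdorff space, hence a homeomorphism. *)
Definition isotopic (D D' : diagram) : Prop :=
  exists (H : R -> 'rV[R]_3 -> 'rV[R]_3) (phi : R -> R),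
    [/\ {within unit_interval `*` sphere, continuous (fun q => H q.1 q.2)},
        forall u, unit_interval u -> set_bij sphere sphere (H u),
        forall p, sphere p -> H 0 p = p,
        set_bij unit_interval unit_interval phi /\
          (forall s t, unit_interval s -> unit_interval t ->
             s < t -> phi s < phi t) &
        (forall t, unit_interval t -> curve D' (phi t) = H 1 (curve D t)) /\
        (forall c, c \in crossings D -> kind D' (phi c.1, phi c.2) = kind D c)].

Definition disc : set (R * R) := [set z | z.1 ^+ 2 + z.2 ^+ 2 <= 1].
Definition open_disc : set (R * R) := [set z | z.1 ^+ 2 + z.2 ^+ 2 < 1].

Definition embedded_disc (h : R * R -> 'rV[R]_3) : Prop :=
  [/\ {within disc, continuous h}, set_inj disc h & h @` disc `<=` sphere].

(* A and A0 are the sets of parameters of the parts of D lying in the closed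
   disc h(disc) and in its interior. *)
Definition meets_disc (D : diagram) h (A A0 : set R) : Prop :=
  forall t, unit_interval t ->
    ((h @` disc) (curve D t) <-> A t) /\
    ((h @` open_disc) (curve D t) <-> A0 t).

(* D and D' coincide outside the closed disc h(disc). *)
Definition local_change (D D' : diagram) (A A0 : set R) : Prop :=
  exists h, [/\ embedded_disc h,
    meets_disc D h A A0, meets_disc D' h A A0,
    forall t, unit_interval t -> ~ A0 t -> curve D t = curve D' t &
    forall c, c \in crossings D -> ~ A c.1 -> kind D c = kind D' c].

Definition crossings_in (D : diagram) (A : set R) : set (R * R) :=
  [set c | c \in crossings D /\ A c.1].

(* In each move below, the pictures inside the disc are described by their
   strands and crossings; this determines them up to isotopy of the disc fixing
   its boundary.  In the pictures, all strands are in general position. *)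

(* A single strand without crossings acquires a kink, classical (Omega_1) or
   virtual (Omega_1^v). *)
Definition move1 (D D' : diagram) : Prop :=
  exists a b : R, [/\ 0 < a, a < b, b < 1,
    local_change D D' `[a, b] `]a, b[ &
    crossings_in D `[a, b] = set0 /\
    exists c, crossings_in D' `[a, b] = [set c]].

(* Two disjoint strands are made to cross twice: either one of them is over at
   both crossings (Omega_2) or both crossings are virtual (Omega_2^v). *)
Definition move2 (D D' : diagram) : Prop :=
  exists a1 b1 a2 b2 : R,
  let A := `[a1, b1] `|` `[a2, b2] in
  [/\ [/\ 0 < a1, a1 < b1, b1 < a2, a2 < b2 & b2 < 1],
      local_change D D' A (`]a1, b1[ `|` `]a2, b2[),
      crossings_in D A = set0 &
      exists s s' t t' : R,
        [/\ a1 < s < b1, a1 < s' < b1, a2 < t < b2, a2 < t' < b2 &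
            [/\ s != s', crossings_in D' A = [set (s, t); (s', t')] &
                kind D' (s, t) = kind D' (s', t')]]].

(* The kinds of the crossings 12, 13, 23 between the strands 1, 2, 3 of a
   triangle, numbered by order of passage.  Omega_3: all are classical and there
   are a top, a middle and a bottom strand, i.e. "over" is not cyclic.
   Omega_3^v: all are virtual.  Omega_3^m: exactly one is classical. *)
Definition triangle_kinds (k12 k13 k23 : crossing_kind) : bool :=
  match k12, k13, k23 with
  | Classical b12, Classical b13, Classical b23 =>
      (b12 == b23) ==> (b13 == b12)
  | Virtual, Virtual, _ | Virtual, _, Virtual | _, Virtual, Virtual => true
  | _, _, _ => false
  end.

(* Three strands cross pairwise once (xij is the parameter on strand i of its
   crossing with strand j) and on each of them the order of the two crossings
   is reversed by the move. *)
Definition move3 (D D' : diagram) : Prop :=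
  exists a1 b1 a2 b2 a3 b3 : R,
  let A := `[a1, b1] `|` `[a2, b2] `|` `[a3, b3] in
  [/\ [/\ 0 < a1, a1 < b1, b1 < a2 & a2 < b2] /\
      [/\ b2 < a3, a3 < b3 & b3 < 1],
      local_change D D' A (`]a1, b1[ `|` `]a2, b2[ `|` `]a3, b3[) &
      exists x12 x13 x21 x23 x31 x32 y12 y13 y21 y23 y31 y32 : R,
      [/\ [/\ a1 < x12 < b1, a1 < x13 < b1, a2 < x21 < b2 & a2 < x23 < b2] /\
          [/\ a3 < x31 < b3 & a3 < x32 < b3],
          [/\ a1 < y12 < b1, a1 < y13 < b1, a2 < y21 < b2 & a2 < y23 < b2] /\
          [/\ a3 < y31 < b3 & a3 < y32 < b3],
          crossings_in D A = [set (x12, x21); (x13, x31); (x23, x32)] /\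
          crossings_in D' A = [set (y12, y21); (y13, y31); (y23, y32)],
          [/\ (x12 < x13) = (y13 < y12), (x21 < x23) = (y23 < y21) &
              (x31 < x32) = (y32 < y31)] &
          [/\ kind D (x12, x21) = kind D' (y12, y21),
              kind D (x13, x31) = kind D' (y13, y31),
              kind D (x23, x32) = kind D' (y23, y32) &
              triangle_kinds (kind D (x12, x21)) (kind D (x13, x31))
                (kind D (x23, x32))]]].

(* Omega_v at the tail and at the head. *)
Definition move_tail (D D' : diagram) : Prop :=
  exists e a b : R,
  let A := `[0, e] `|` `[a, b] in
  [/\ [/\ 0 < e, e < a, a < b & b < 1],
      local_change D D' A (`[0, e[ `|` `]a, b[),
      crossings_in D A = set0 &
      exists s t, [/\ 0 < s < e, a < t < b,
        crossings_in D' A = [set (s, t)] & kind D' (s, t) = Virtual]].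

Definition move_head (D D' : diagram) : Prop :=
  exists a b e : R,
  let A := `[a, b] `|` `[e, 1] in
  [/\ [/\ 0 < a, a < b, b < e & e < 1],
      local_change D D' A (`]a, b[ `|` `]e, 1]),
      crossings_in D A = set0 &
      exists s t, [/\ a < s < b, e < t < 1,
        crossings_in D' A = [set (s, t)] & kind D' (s, t) = Virtual]].

Definition elementary (D D' : diagram) : Prop :=
  [\/ isotopic D D', move1 D D' | move2 D D'] \/
  [\/ move3 D D', move_tail D D' | move_head D D'].

Definition equivalent : diagram -> diagram -> Prop :=
  clos_refl_sym_trans diagram elementary.

Record virtual_knotoid := VirtualKnotoid {
  diagrams_of : set diagram;
  diagrams_ofP : exists D, diagrams_of = [set D' | equivalent D D']
}.

Section Invariants.
Variable D : diagram.

Definition is_classical (c : R * R) : bool :=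
  if kind D c is Classical _ then true else false.

Definition over (c : R * R) : R :=
  if kind D c is Classical true then c.1 else c.2.
Definition under (c : R * R) : R :=
  if kind D c is Classical true then c.2 else c.1.

(* At a crossing passed at the parameters s and t and drawn with both strands
   upward, the strand at s goes from bottom left to top right (and that at t
   from bottom right to top left). *)
Definition from_left (s t : R) : bool :=
  0 < det3 (curve D s) (derive1 (curve D) s) (derive1 (curve D) t).

Definition sgn (c : R * R) : int :=
  if from_left (over c) (under c) then 1 else -1.

(* The parameters of c on its strand starting at the bottom left and on its
   strand starting at the bottom right. *)
Definition left_in (c : R * R) : R := if from_left c.1 c.2 then c.1 else c.2.
Definition right_in (c : R * R) : R := if from_left c.1 c.2 then c.2 else c.1.

(* The change of the label along the strand at s, at its crossing with the
   strand at t. *)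
Definition label_step (s t : R) : int := if from_left s t then -1 else 1.

(* The label of the arc ending at the parameter s: the sum of the changes at
   all earlier passages through classical crossings. *)
Definition label (s : R) : int :=
  \sum_(c <- crossings D | is_classical c)
    ((if c.1 < s then label_step c.1 c.2 else 0) +
     (if c.2 < s then label_step c.2 c.1 else 0)).

Definition weight (c : R * R) : int :=
  sgn c * (label (left_in c) - (label (right_in c) + 1)).

(* The two components of the smoothing at c, as sets of parameters: the closed
   one and the one containing tail and head. *)
Definition loop_part (c : R * R) (t : R) : bool := c.1 < t < c.2.
Definition open_part (c : R * R) (t : R) : bool := (t < c.1) || (c.2 < t).

(* The left smoothed strand comes in at [left_in c] and leaves at [right_in c];
   it lies on the loop iff it comes in at the second passage through c. *)
Definition left_part (c : R * R) : R -> bool :=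
  if left_in c == c.2 then loop_part c else open_part c.
Definition right_part (c : R * R) : R -> bool :=
  if right_in c == c.2 then loop_part c else open_part c.

Definition D1 (c : R * R) : R -> bool :=
  if sgn c == 1 then left_part c else right_part c.
Definition D2 (c : R * R) : R -> bool :=
  if sgn c == 1 then right_part c else left_part c.

Definition between (c e : R * R) : bool :=
  is_classical e && (D1 c e.1 && D2 c e.2 || D2 c e.1 && D1 c e.2).

Definition crossing_number (c : R * R) : nat :=
  count (between c) (crossings D).

Definition ind (c e : R * R) : int :=
  if D1 c (over e) then sgn e else - sgn e.

Definition intersection_index (c : R * R) : int :=
  \sum_(e <- crossings D | between c e) ind c e.

Definition even_crossing (c : R * R) : bool :=
  is_classical c && ~~ odd (crossing_number c).
Definition odd_crossing (c : R * R) : bool :=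
  is_classical c && odd (crossing_number c).

End Invariants.
End Diagrams.

(* Laurent polynomials are taken in the fraction fields of Z[t] and Z[x][y],
   which contain Z[t^{+-1}] and Z[x^{+-1}, y^{+-1}] as subrings. *)
Definition t_var : {fraction {poly int}} := tofrac 'X.
Definition x_var : {fraction {poly {poly int}}} := tofrac ('X%:P).
Definition y_var : {fraction {poly {poly int}}} := tofrac 'X.

Definition affine_index_poly (R : realType) (D : diagram R) :
    {fraction {poly int}} :=
  \sum_(c <- crossings D | is_classical D c)
    (sgn D c)%:~R * (t_var ^ weight D c - 1).

Definition parity_poly (R : realType) (D : diagram R) :
    {fraction {poly {poly int}}} :=
  \sum_(c <- crossings D | even_crossing D c)
    (sgn D c * intersection_index D c)%:~R * x_var ^ weight D c +
  \sum_(c <- crossings D | odd_crossing D c)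
    (sgn D c * intersection_index D c)%:~R * y_var ^ weight D c.

(* Main.v *)
Require Import Defs.
From mathcomp Require Import all_boot all_order all_algebra.
From mathcomp Require Import perm finmap zify ring.
From mathcomp Require Import all_classical all_reals all_analysis.

Import Order.TTheory GRing.Theory Num.Theory.

(** Both polynomials carry exactly the numbers
      a_n = sum of sgn(c) over the classical crossings c of weight n, n <> 0.

    The point is that i(c) = - W(c).  Let S be the sum of the label changes met
    on the closed component of the smoothing at c, apart from the passages
    through c itself.  The labels of the two arcs arriving at c differ by S plus
    the change made at c, and the correction + 1 in the weight absorbs the
    latter, so W(c) = S or - S.  A crossing met twice by the closed component
    contributes opposite changes to S, and a crossing between the two components
    contributes one change, which is its index up to a sign depending only on c;
    so i(c) is S or - S as well, and the signs turn out to be always opposite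
    ([intersection_index_weight]).  Moreover the number of crossings between the
    components has the parity of a sum of that many signs, so c is odd exactly
    when W(c) is odd ([crossing_number_parity]).  Hence
      P_D = sum over n of - n a_n z_n^n   with z_n = y for odd n, x for even n,
      AI_D = sum over n of a_n (t^n - 1).
    In both sums the term n = 0 vanishes, and for n <> 0 the coefficient of the
    n-th power determines a_n, because Z has no zero divisors.

    To compare two diagrams D and E, the argument is applied to the formal
    difference of their families of signed weights: AI and P agree on D and E if
    and only if all its coefficients of nonzero exponent vanish
    ([affine_index_poly_eq], [parity_poly_eq]).  Coefficients of Laurent
    polynomials inside a fraction field are reached by clearing denominators;
    for P the two variables are then identified, which loses nothing since the
    exponents already separate the terms ([laurent_coef_eq0]). *)

(** * Intersection index and weight of a crossing *)

Section SmoothingLoop.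
Local Open Scope ring_scope.
Context {R : realType}.
Variable D : diagram R.
Implicit Types c e : R * R.

Lemma det3_swap (p u v : 'rV[R]_3) : det3 p v u = - det3 p u v.
Proof.
rewrite /det3.
(* The last two rows, as indices of the nested blocks. *)
pose i1 : 'I_3 := rshift 1 (lshift 1 (ord0 : 'I_1)).
pose i2 : 'I_3 := rshift 1 (rshift 1 (ord0 : 'I_1)).
have e1 (a b : 'rV[R]_3) j :
    (col_mx p (col_mx a b) : 'M[R]_3) i1 j = a ord0 j.
  exact: etrans (col_mxEd _ _ (lshift 1 ord0) j) (col_mxEu _ _ ord0 j).
have e2 (a b : 'rV[R]_3) j :
    (col_mx p (col_mx a b) : 'M[R]_3) i2 j = b ord0 j.
  exact: etrans (col_mxEd _ _ (rshift 1 ord0) j) (col_mxEd _ _ ord0 j).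
have -> : (col_mx p (col_mx v u) : 'M[R]_3) =
    xrow i1 i2 (col_mx p (col_mx u v)).
  apply/matrixP => i j; rewrite [RHS]mxE.
  case: (splitP (i : 'I_(1 + 2))) => [k ik|k ik].
    have -> : i = lshift 2 k by apply/val_inj.
    rewrite [k]ord1 tpermD //.
    exact: etrans (col_mxEu _ _ ord0 j) (esym (col_mxEu _ _ ord0 j)).
  have -> : i = rshift 1 k by apply/val_inj.
  case: (splitP (k : 'I_(1 + 1))) => [l kl|l kl].
    have -> : k = lshift 1 l by apply/val_inj.
    have -> : l = ord0 by rewrite ord1.
    by rewrite tpermL [LHS]e1 e2.
  have -> : k = rshift 1 l by apply/val_inj.
  have -> : l = ord0 by rewrite ord1.
  by rewrite tpermR [LHS]e2 e1.
by rewrite xrowE det_mulmx det_perm odd_tperm expr1 mulN1r.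
Qed.

Lemma crossing_lt c : c \in crossings D -> c.1 < c.2.
Proof. by case: c => s t /crossingsP[]. Qed.

(** The two strands are transverse at a crossing, so exactly one of them comes
    from the left of the other. *)
Lemma label_step_swap c : c \in crossings D ->
  label_step D c.2 c.1 = - label_step D c.1 c.2.
Proof.
case: c => s t c_in /=; have /crossingsP[_ _ _ st] := c_in.
have := crossing_transverse c_in; rewrite /label_step /from_left -st.
rewrite [det3 _ (_ t) _]det3_swap oppr_gt0 oppr_eq0.
by case: ltgtP => // <-; rewrite eqxx.
Qed.

(** There are no triple points, so two crossings that share a parameter are
    equal. *)
Lemma distinct_passages c e : c \in crossings D -> e \in crossings D ->
  e != c -> [/\ e.1 != c.1, e.1 != c.2, e.2 != c.1 & e.2 != c.2].
Proof.
case: c e => [s t] [u v] c_in e_in /= e_neq_c.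
have /crossingsP[s0 st t1 cst] := c_in.
have /crossingsP[u0 uv v1 cuv] := e_in.
have no3 a b d : 0 <= a -> a < b -> b < d -> d <= 1 ->
    curve D a = curve D b -> curve D b = curve D d -> False.
  by move=> a0 ab bd d1 ? ?; case: (@crossing_double _ D a b d).
split; apply/eqP => eq_pass; subst.
- have /eqP tv : v != t by apply: contraNneq e_neq_c => ->.
  have [vt|tv'|//] := ltgtP v t.
    by apply: (no3 s v t) => //; rewrite -cuv.
  by apply: (no3 s t v) => //; rewrite -cst.
- exact: (no3 s t v).
- exact: (no3 u s t).
- have /eqP us : u != s by apply: contraNneq e_neq_c => ->.
  have [us'|su|//] := ltgtP u s.
    by apply: (no3 u s t) => //; rewrite cuv.
  by apply: (no3 s u t) => //; rewrite cuv.
Qed.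

(** The contribution of e to the sum S of the label changes along the closed
    component of the smoothing at c. *)
Definition loop_step c e : int :=
  (if loop_part c e.1 then label_step D e.1 e.2 else 0) +
  (if loop_part c e.2 then label_step D e.2 e.1 else 0).

(** Travelling from the first to the second passage through c runs once along
    the closed component, after the change made at c itself. *)
Lemma label_loop c : c \in crossings D -> is_classical D c ->
  label D c.2 - label D c.1 =
  label_step D c.1 c.2 +
  \sum_(e <- crossings D | is_classical D e) loop_step c e.
Proof.
move=> c_in c_cl; have c12 := crossing_lt c c_in.
(* The crossing c gives the first summand, since its passages bound the loop. *)
rewrite /label -sumrB big_mkcond [in RHS]big_mkcond /=.
rewrite !(bigD1_seq c c_in (fset_uniq _)) /= c_cl addrA; congr (_ + _).
  rewrite /loop_step /loop_part !ltxx c12 /= ltNge (ltW c12) /=; ring.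
rewrite [LHS]big_seq_cond [RHS]big_seq_cond.
apply: eq_bigr => e /andP[e_in e_neq_c]; case: (is_classical D e) => //.
have [e11 e12 e21 e22] := distinct_passages c e c_in e_in e_neq_c.
have passage p x : p != c.1 -> (if p < c.2 then x else 0) -
    (if p < c.1 then x else 0) = if loop_part c p then x else 0 :> int.
  rewrite /loop_part; case: (ltgtP p c.1) => //= pc _.
    by rewrite (lt_trans pc c12) subrr.
  by rewrite subr0.
by rewrite opprD addrACA; congr (_ + _); exact: passage.
Qed.

Definition loop_is_D1 c : bool := (sgn D c == 1) (+) from_left D c.1 c.2.

Lemma D1E c : c \in crossings D ->
  D1 D c = if loop_is_D1 c then loop_part c else open_part c.
Proof.
move=> /crossing_lt/lt_eqF c12.
rewrite /D1 /loop_is_D1 /left_part /right_part /left_in /right_in.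
by case: (sgn D c == 1); case: (from_left _ _ _); rewrite ?c12 ?eqxx.
Qed.

Lemma D2E c : c \in crossings D ->
  D2 D c = if loop_is_D1 c then open_part c else loop_part c.
Proof.
move=> /crossing_lt/lt_eqF c12.
rewrite /D2 /loop_is_D1 /left_part /right_part /left_in /right_in.
by case: (sgn D c == 1); case: (from_left _ _ _); rewrite ?c12 ?eqxx.
Qed.

Lemma open_partE c e : c \in crossings D -> e \in crossings D -> e != c ->
  (open_part c e.1 = ~~ loop_part c e.1) *
  (open_part c e.2 = ~~ loop_part c e.2).
Proof.
move=> c_in e_in e_neq_c; have c12 := crossing_lt c c_in.
have [e11 e12 e21 e22] := distinct_passages c e c_in e_in e_neq_c.
rewrite /open_part /loop_part !negb_and -!leNgt.
by rewrite !le_eqVlt (negbTE e11) (negbTE e21) ![c.2 == _]eq_sym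
  (negbTE e12) (negbTE e22).
Qed.

Lemma not_between_self c : c \in crossings D -> between D c c = false.
Proof.
move=> c_in; rewrite /between D1E // D2E //.
rewrite /loop_part /open_part; case: (loop_is_D1 c);
  by rewrite !ltxx /= !(andbF, andbT).
Qed.

Lemma betweenE c e : c \in crossings D -> e \in crossings D ->
  between D c e = is_classical D e && (loop_part c e.1 != loop_part c e.2).
Proof.
move=> c_in e_in; have [->|e_neq_c] := eqVneq e c.
  by rewrite not_between_self // /loop_part !ltxx andbF eqxx andbF.
have [op1 op2] := open_partE c e c_in e_in e_neq_c.
rewrite /between D1E // D2E //; congr (_ && _).
by case: (loop_is_D1 c); rewrite op1 op2;
  case: (loop_part c e.1); case: (loop_part c e.2).
Qed.

(** A crossing of the closed component with itself raises the label at one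
    passage and lowers it at the other. *)
Lemma loop_step_notin c e : e \in crossings D ->
  loop_part c e.1 = loop_part c e.2 -> loop_step c e = 0.
Proof.
move=> e_in; rewrite /loop_step label_step_swap // => ->.
by case: ifP; rewrite ?subrr ?addr0.
Qed.

(** If the over-strand of e goes from left to right then sgn e = 1 and the label
    decreases along it and increases along the under-strand; for sgn e = -1 the
    changes are reversed.  So ind e is minus the label change along D1, that is,
    the label change along D2. *)
Lemma ind_loop_step c e : c \in crossings D -> e \in crossings D ->
  between D c e ->
  ind D c e = if loop_is_D1 c then - loop_step c e else loop_step c e.
Proof.
move=> c_in e_in be.
have e_neq_c : e != c.
  by apply: contraTneq be => ->; rewrite not_between_self.
have [op1 op2] := open_partE c e c_in e_in e_neq_c.
move: be; rewrite betweenE // => /andP[_ loop12].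
have flip := label_step_swap e e_in.
have -> : ind D c e = if D1 D c (Defs.over D e)
    then - label_step D (Defs.over D e) (Defs.under D e)
    else label_step D (Defs.over D e) (Defs.under D e).
  rewrite /ind /sgn /label_step.
  by case: (from_left _ _ _); case: (D1 _ _ _).
rewrite D1E // /loop_step /Defs.over /Defs.under.
case: (kind D e) => [|[|]]; case: (loop_is_D1 c) => /=;
  rewrite ?op1 ?op2 {op1 op2}; move: loop12 flip;
  move: (label_step D e.1 e.2) (label_step D e.2 e.1) => x y;
  case: (loop_part c e.1); case: (loop_part c e.2) => //= _ yx;
  by rewrite ?addr0 ?add0r ?yx ?opprK.
Qed.

Lemma intersection_index_loop c : c \in crossings D ->
  intersection_index D c =
  (-1) ^+ loop_is_D1 c *
    \sum_(e <- crossings D | is_classical D e) loop_step c e.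
Proof.
move=> c_in; rewrite /intersection_index mulr_sumr.
rewrite [LHS]big_seq_cond [RHS]big_seq_cond.
rewrite [RHS](bigID (between D c)) /= [X in _ = _ + X]big1 ?addr0; last first.
  move=> e /andP[/andP[e_in e_cl]].
  rewrite betweenE // e_cl /= negbK => /eqP loop12.
  by rewrite loop_step_notin // mulr0.
apply: eq_big => [e|e /andP[e_in be]].
  case: (boolP (e \in _)) => //= e_in.
  by rewrite betweenE //; case: (is_classical D e).
rewrite ind_loop_step //.
by case: (loop_is_D1 c); rewrite ?mulN1r ?mul1r.
Qed.

(** Both sides are S up to sign, and the sign depends only on the four cases for
    sgn c and for the side from which the first strand arrives. *)
Lemma intersection_index_weight c : c \in crossings D -> is_classical D c ->
  intersection_index D c = - weight D c.
Proof.
move=> c_in c_cl; rewrite intersection_index_loop //.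
have := label_loop c c_in c_cl.
rewrite /weight /loop_is_D1 /left_in /right_in.
set S := \sum_(e <- _ | _) _; rewrite /label_step.
have : sgn D c = 1 \/ sgn D c = -1.
  by rewrite /sgn; case: ifP; [left|right].
by case: (from_left D c.1 c.2) => -[] -> /=; rewrite ?expr0 ?expr1; lia.
Qed.

(** The intersection index is a sum of [crossing_number] terms 1 or -1. *)
Lemma crossing_number_parity c : c \in crossings D -> is_classical D c ->
  odd (crossing_number D c) = odd `|weight D c|.
Proof.
move=> c_in c_cl.
rewrite -[weight D c]opprK -intersection_index_weight // abszN.
rewrite /crossing_number /intersection_index -sum1_count.
elim/big_ind2: _ => // [x y m n xm yn|e _].
  by rewrite oddD xm yn; lia.
by rewrite /ind /sgn; case: ifP; case: ifP.
Qed.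

End SmoothingLoop.

(** * Coefficients of Laurent polynomials in a fraction field *)

Section LaurentSums.
Local Open Scope ring_scope.

(** A list of pairs (coefficient, exponent) stands for a Laurent polynomial in
    which exponents may be repeated. *)
Definition laurent_coef (s : seq (int * int)) (n : int) : int :=
  \sum_(p <- s | p.2 == n) p.1.

Lemma sum_by_exponent (F : pzRingType) (s : seq (int * int)) (G : int -> F) :
  \sum_(p <- s) p.1%:~R * G p.2 =
  \sum_(n <- undup [seq p.2 | p <- s]) (laurent_coef s n)%:~R * G n.
Proof.
under [RHS]eq_bigr do rewrite /laurent_coef rmorph_sum mulr_suml big_mkcond /=.
rewrite exchange_big /= big_seq [RHS]big_seq; apply: eq_bigr => p p_s.
rewrite (bigD1_seq p.2) ?undup_uniq ?mem_undup ?map_f //= eqxx big1 ?addr0 //.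
by move=> n /negbTE; rewrite eq_sym => ->.
Qed.

(** After multiplication by (u v)^N the sum lies in A, where phi sends both u
    and v to 'X and so turns the term of exponent k into a multiple of
    'X^(k + 2N).  Each exponent may thus choose its own variable, u or v. *)
Lemma laurent_coef_eq0 (A : idomainType) (phi : {rmorphism A -> {poly int}})
    (u v : A) (b : int -> bool) (s : seq (int * int)) :
  phi u = 'X -> phi v = 'X ->
  \sum_(p <- s) p.1%:~R * (if b p.2 then tofrac u else tofrac v) ^ p.2 = 0 ->
  forall n, laurent_coef s n = 0.
Proof.
move=> phiu phiv s0 n.
have neq0 w : phi w = 'X -> tofrac w != 0.
  rewrite tofrac_eq0 => phiw; apply/eqP => w0.
  by move: phiw; rewrite w0 rmorph0 => /esym/eqP; rewrite polyX_eq0.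
have [u0 v0] := (neq0 u phiu, neq0 v phiv).
(* Large enough for n and for all the exponents of s. *)
pose N : nat := (`|n| + \sum_(p <- s) `|p.2|)%N.
have leN p : p \in s -> (`|p.2| <= N)%N.
  by move=> p_s; rewrite /N (big_rem p) //=; lia.
have nN : (`|n| <= N)%N by rewrite /N leq_addr.
pose m (k : int) : nat := `|(k + N%:Z)%R|%N.
have mE k : (`|k| <= N)%N -> (m k)%:Z = k + N%:Z by rewrite /m; lia.
pose Q : A := \sum_(p <- s) p.1%:~R *
  (if b p.2 then u ^+ m p.2 * v ^+ N else v ^+ m p.2 * u ^+ N).
have Q0 : Q = 0.
  apply/eqP; rewrite -tofrac_eq0 -(mulr0 ((tofrac u * tofrac v) ^+ N)) -s0.
  rewrite mulr_sumr rmorph_sum /= big_seq [X in _ == X]big_seq; apply/eqP.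
  apply: eq_bigr => p /leN pN.
  have shift (z : {fraction A}) : z != 0 -> z ^+ m p.2 = z ^ p.2 * z ^+ N.
    move=> z0; have -> : z ^+ m p.2 = z ^ (m p.2)%:Z by [].
    by rewrite mE // expfzDr.
  rewrite rmorphM rmorph_int /=.
  by case: (b p.2); rewrite rmorphM !rmorphXn /= shift // exprMn; ring.
have : (phi Q)`_(m n + N) = 0 by rewrite Q0 rmorph0 coef0.
rewrite rmorph_sum coef_sum => {}s0.
rewrite /laurent_coef big_mkcond -[RHS]s0 big_seq [RHS]big_seq /=.
apply: eq_bigr => p /leN pN.
have -> : phi (p.1%:~R * (if b p.2 then u ^+ m p.2 * v ^+ N
    else v ^+ m p.2 * u ^+ N)) = p.1 *: 'X^(m p.2 + N).
  rewrite rmorphM rmorph_int -mul_polyC -[X in _ = X%:P * _]intz rmorph_int.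
  by congr (_ * _); case: ifP => _;
    rewrite rmorphM !rmorphXn /= phiu phiv exprD.
rewrite coefZ coefXn eqn_add2r.
have -> : (m n == m p.2) = (p.2 == n).
  by rewrite -eqz_nat !mE // (inj_eq (addIr _)) eq_sym.
by case: ifP; rewrite ?mulr1 ?mulr0.
Qed.

Lemma sum_eq0_of_coef (F : pzRingType) (s : seq (int * int)) (G : int -> F) :
  G 0 = 0 -> (forall n, n != 0 -> laurent_coef s n = 0) ->
  \sum_(p <- s) p.1%:~R * G p.2 = 0.
Proof.
move=> G0 s0; rewrite sum_by_exponent big1 // => n _.
by have [->|/s0->] := eqVneq n 0; rewrite ?G0 ?mulr0 ?mul0r.
Qed.

Lemma affine_sum_eq0 (s : seq (int * int)) :
  \sum_(p <- s) p.1%:~R * (t_var ^ p.2 - 1) = 0 <->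
  forall n, n != 0 -> laurent_coef s n = 0.
Proof.
split=> [s0 n n0|]; last first.
  apply: (sum_eq0_of_coef _ s (fun n => t_var ^ n - 1)).
  by rewrite expr0z subrr.
(* The terms - 1 only affect the coefficient of exponent 0. *)
pose s' := (- \sum_(p <- s) p.1, 0) :: s.
have -> : laurent_coef s n = laurent_coef s' n.
  by rewrite /laurent_coef big_cons /= eq_sym (negbTE n0).
apply: (laurent_coef_eq0 _ idfun 'X 'X xpredT) => //.
rewrite big_cons /= expr0z mulr1 rmorphN rmorph_sum addrC -[RHS]s0.
by rewrite -sumrB; apply: eq_bigr => p _; rewrite mulrBr mulr1.
Qed.

Definition parity_var (n : int) : {fraction {poly {poly int}}} :=
  if odd `|n| then y_var else x_var.

Lemma parity_sum_eq0 (s : seq (int * int)) :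
  \sum_(p <- s) p.1%:~R * ((- p.2)%:~R * parity_var p.2 ^ p.2) = 0 <->
  forall n, n != 0 -> laurent_coef s n = 0.
Proof.
split=> [s0 n n0|]; last first.
  apply: (sum_eq0_of_coef _ s (fun n => (- n)%:~R * parity_var n ^ n)).
  by rewrite oppr0 mul0r.
pose s' := [seq (- p.2 * p.1, p.2) | p <- s].
suff : laurent_coef s' n = 0.
  rewrite /laurent_coef big_map /= (eq_bigr (fun p => - n * p.1)).
    rewrite -mulr_sumr => /eqP.
    by rewrite mulf_eq0 oppr_eq0 (negbTE n0) => /eqP.
  by move=> p /eqP->.
(* Evaluating the outer variable y at the inner variable x. *)
apply: (laurent_coef_eq0 _ (horner_eval ('X : {poly int})) 'X 'X%:P
  (fun k => odd `|k|)).
- exact: hornerX.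
- exact: hornerC.
rewrite -[RHS]s0 big_map; apply: eq_bigr => p _.
by rewrite /= mulrA -intrM [- _ * _]mulrC.
Qed.

End LaurentSums.

(** * The two polynomials as sums over signed weights *)

Section SignedWeights.
Local Open Scope ring_scope.
Context {R : realType}.

Definition signed_weights (D : diagram R) : seq (int * int) :=
  [seq (sgn D c, weight D c) | c <- crossings D & is_classical D c].

Lemma affine_index_polyE (D : diagram R) :
  affine_index_poly D =
  \sum_(p <- signed_weights D) p.1%:~R * (t_var ^ p.2 - 1).
Proof. by rewrite big_map big_filter. Qed.

Lemma parity_polyE (D : diagram R) :
  parity_poly D =
  \sum_(p <- signed_weights D) p.1%:~R * ((- p.2)%:~R * parity_var p.2 ^ p.2).
Proof.
rewrite big_map big_filter /parity_poly.
rewrite [RHS](bigID (fun c => odd (crossing_number D c))) /= addrC.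
(* The variable attached to c by its parity is the one given by its weight. *)
have termE c : c \in crossings D -> is_classical D c ->
    (sgn D c * intersection_index D c)%:~R *
      (if odd (crossing_number D c) then y_var else x_var) ^ weight D c =
    (sgn D c)%:~R * ((- weight D c)%:~R * parity_var (weight D c) ^ weight D c).
  move=> c_in c_cl; rewrite intersection_index_weight // mulrA.
  rewrite crossing_number_parity // -/(parity_var _).
  by congr (_ * (_ ^ _)); exact: intrM.
congr (_ + _); rewrite big_seq_cond [RHS]big_seq_cond;
  apply: eq_bigr => c /and3P[c_in c_cl c_odd]; have := termE c c_in c_cl.
  by rewrite (negbTE c_odd).
by rewrite c_odd.
Qed.

Definition weight_difference (D E : diagram R) : seq (int * int) :=
  signed_weights D ++ [seq (- p.1, p.2) | p <- signed_weights E].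

Lemma sum_weight_difference (F : pzRingType) (G : int -> F) (D E : diagram R) :
  \sum_(p <- weight_difference D E) p.1%:~R * G p.2 =
  \sum_(p <- signed_weights D) p.1%:~R * G p.2 -
  \sum_(p <- signed_weights E) p.1%:~R * G p.2.
Proof.
rewrite big_cat /= -sumrN; congr (_ + _).
by rewrite big_map; apply: eq_bigr => p _; rewrite rmorphN mulNr.
Qed.

Lemma affine_index_poly_eq (D E : diagram R) :
  affine_index_poly D = affine_index_poly E <->
  forall n, n != 0 -> laurent_coef (weight_difference D E) n = 0.
Proof.
apply: iff_trans (affine_sum_eq0 _).
rewrite (sum_weight_difference _ (fun n => t_var ^ n - 1)).
rewrite -!affine_index_polyE.
by split=> [->|/subr0_eq //]; exact: subrr.
Qed.

Lemma parity_poly_eq (D E : diagram R) :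
  parity_poly D = parity_poly E <->
  forall n, n != 0 -> laurent_coef (weight_difference D E) n = 0.
Proof.
apply: iff_trans (parity_sum_eq0 _).
rewrite (sum_weight_difference _ (fun n => (- n)%:~R * parity_var n ^ n)).
rewrite -!parity_polyE.
by split=> [->|/subr0_eq //]; exact: subrr.
Qed.

End SignedWeights.

Theorem theorem3p1 (R : realType) (K1 K2 : virtual_knotoid R)
    (D E : diagram R)
    (hK1 : diagrams_of K1 D) (hK2 : diagrams_of K2 E) :
  affine_index_poly D = affine_index_poly E <->
  parity_poly D = parity_poly E.
Proof.
exact: iff_trans (affine_index_poly_eq D E) (iff_sym (parity_poly_eq D E)).
Qed.
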